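(* Let $b\ge1$ and $n\ge1$. If $A=C_{i_1}\cdots C_{i_n}$ is a juggling card sequence whose $n$ cards are chosen independently and uniformly at random from $\{C_1,\dots,C_b\}$, then the probability that $\pi_A$ is a single cycle of length $b$ is exactly $1/b$ (independent of $n$).
   Context: There are $b$ balls on levels $1,\dots,b$. For $1\le i\le b$ the card $C_i$ induces the permutation $\pi_{C_i}$ of $[b]$ with $\pi_{C_i}(1)=i$, $\pi_{C_i}(j)=j-1$ for $2\le j\le i$, $\pi_{C_i}(j)=j$ for $j>i$. For $A=C_{i_1}\cdots C_{i_n}$, $\pi_A=\pi_{C_{i_n}}\circ\cdots\circ\pi_{C_{i_1}}$ (the ball starting at level $j$ ends at level $\pi_A(j)$). *)

(* Defs.v *)
From HB Require Import structures.
From mathcomp Require Import all_boot all_order all_algebra all_fingroup.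
From mathcomp Require Import zify.
Set Implicit Arguments.
Unset Strict Implicit.
Unset Printing Implicit Defensive.
Import Order.TTheory GRing.Theory Num.Theory.

(* Levels and cards are numbered from 0: the ordinal j : 'I_b stands for
   level j + 1, and i : 'I_b stands for the card C_(i + 1). *)
Definition card_fun (b : nat) (i j : 'I_b) : 'I_b :=
  if j == 0 :> nat then i
  else if j <= i then Ordinal (leq_ltn_trans (leq_pred j) (ltn_ord j))
  else j.

Lemma card_fun_inj (b : nat) (i : 'I_b) : injective (card_fun i).
Proof.
move=> j k /(congr1 val) E; apply: val_inj; move: E; rewrite /card_fun.
case: i j k => i hi [j hj] [k hk] /=.
by do 4?case: ifP => /=; lia.
Qed.

Definition pi_card (b : nat) (i : 'I_b) : 'S_b := perm (@card_fun_inj b i).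

(* The product of permutations is in diagrammatic order, (s * t) x = t (s x),
   so this is pi_card i_n \o ... \o pi_card i_1. *)
Definition pi_seq (b n : nat) (A : n.-tuple 'I_b) : 'S_b :=
  (\prod_(i <- A) pi_card i)%g.

Definition single_full_cycle (b : nat) (s : 'S_b) : bool :=
  porbits s == [set [set: 'I_b]].

Definition uniform_pmf (T : finType) (x : T) : rat := (#|T|%:R^-1)%R.

(* Probability of the event E for n independent draws, each with probability
   mass function p. *)
Definition iid_prob (T : finType) (n : nat) (p : T -> rat)
    (E : pred (n.-tuple T)) : rat :=
  (\sum_(A : n.-tuple T | E A) \prod_(k < n) p (tnth A k))%R.

(* Main.v *)
Require Import Defs.
From mathcomp Require Import all_boot all_order all_algebra all_fingroup.

(* Read backwards in time, a card sends the ball at some level to level 1, so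
   card sequences correspond to words x over the balls acting on the list of
   balls by move-to-front.  Suppose that the last move is a, let c be the ball
   at level 1 in the initial list, and suppose a <> c (otherwise c is fixed).
   Short-circuiting c in the permutation c |-> a, p |-> c gives the permutation
   on the other b - 1 balls that belongs to the word obtained from the earlier
   moves by deleting the letters a, replacing c by a, and making a the first
   move.  Counting fibres, the number N_b(n) of words of length n that give a
   full cycle satisfies
     N_b(n + 1) = \sum_m 'C(n, m) N_(b-1)(m + 1) = \sum_m 'C(n, m) (b - 1)^m
                = b^n. *)

Set Implicit Arguments.
Unset Strict Implicit.
Unset Printing Implicit Defensive.
Import GRing.Theory Num.Theory.

(** * Sums over all words of a given length *)

Section WordSum.
Variable T : Type.
Implicit Types (s x : seq T) (g : seq T -> nat).

(** The alphabet is a list, so that an induction can drop a letter without changing the type. *)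
Fixpoint wsum s n g : nat :=
  if n is m.+1 then \sum_(t <- s) wsum s m (fun x => g (t :: x)) else g [::].

Lemma wsum_sum (I : Type) (r : seq I) s n (F : I -> seq T -> nat) :
  wsum s n (fun x => \sum_(i <- r) F i x) = \sum_(i <- r) wsum s n (F i).
Proof.
elim: n F => [|n IHn] F //=.
by rewrite exchange_big /=; apply: eq_bigr => t _; rewrite IHn.
Qed.

Lemma wsum_const s n k : wsum s n (fun=> k) = size s ^ n * k.
Proof.
elim: n => [|n IHn] /=; first by rewrite mul1n.
by rewrite IHn big_const_seq count_predT iter_addn_0 expnSr mulnAC.
Qed.

Lemma wsum_rcons s n g :
  \sum_(a <- s) wsum s n (fun x => g (rcons x a)) = wsum s n.+1 g.
Proof.
elim: n g => [|n IHn] g //=; rewrite exchange_big /=.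
by apply: eq_bigr => t _; rewrite (IHn (fun x => g (t :: x))).
Qed.

(** Pascal's rule: [m] letters are spread over [n.+1] places, and the first place is either blank or
    holds a letter [t]. *)
Lemma wsum_binomial s n g :
  \sum_(m < n.+2) 'C(n.+1, m) * wsum s m g =
  \sum_(m < n.+1) 'C(n, m) * wsum s m g +
  \sum_(t <- s) \sum_(m < n.+1) 'C(n, m) * wsum s m (fun x => g (t :: x)).
Proof.
rewrite exchange_big /= big_ord_recl [in RHS]big_ord_recl /= !bin0 -addnA.
congr (_ + _); rewrite (eq_bigr (fun m : 'I_n.+1 =>
    'C(n, m.+1) * wsum s m.+1 g + 'C(n, m) * wsum s m.+1 g)); last first.
  by move=> m _; rewrite /bump /= add1n binS mulnDl.
rewrite big_split /= big_ord_recr /= bin_small // mul0n addn0.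
by congr (_ + _); apply: eq_bigr => m _; rewrite big_distrr.
Qed.

End WordSum.

Lemma eq_wsum (T : eqType) (s : seq T) n (g h : seq T -> nat) :
  (forall x, {subset x <= s} -> g x = h x) -> wsum s n g = wsum s n h.
Proof.
elim: n g h => [|n IHn] g h E /=; first exact: E.
rewrite big_seq [RHS]big_seq; apply: eq_bigr => t ts; apply: IHn => x xs.
by apply: E => u /[!inE] /predU1P[->|/xs].
Qed.

(** * Moves to the front and contraction of words *)

Section MoveToFront.
Variable T : eqType.
Implicit Types (a c t : T) (s w x : seq T).

Definition mtf t w := t :: rem t w.

(* The head of x is the last move performed. *)
Definition play s x := foldr mtf s x.

Lemma perm_play s x : {subset x <= s} -> perm_eq (play s x) s.
Proof.
elim: x => [|t x IHx] //= xs.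
have /IHx p : {subset x <= s} by move=> u ux; apply: xs; rewrite inE ux orbT.
have tp: t \in play s x by rewrite (perm_mem p) xs ?mem_head.
by rewrite perm_sym /mtf -(permPr (perm_to_rem tp)) perm_sym.
Qed.

Definition subst c a v := if v == c then a else v.

Definition contract c a x := [seq subst c a v | v <- x & v != a].

Lemma rem_comm a t w : rem a (rem t w) = rem t (rem a w).
Proof.
elim: w => //= v w IHw.
case: (eqVneq v t) => [->|vt] /=; case: eqVneq => [va|_] //=.
- by rewrite va.
- by rewrite eqxx.
- by rewrite (negPf vt) IHw.
Qed.

(** With [a] absent, [subst c a] identifies no two of the letters concerned. *)
Lemma map_subst_rem c a t w : a \notin w -> t != a ->
  map (subst c a) (rem t w) = rem (subst c a t) (map (subst c a) w).
Proof.
move=> + ta; elim: w => //= v w IHw; rewrite inE => /norP[av aw].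
rewrite [in RHS](_ : (subst c a v == subst c a t) = (v == t)).
  by case: eqP => //= _; rewrite IHw.
rewrite /subst; case: (eqVneq v c) => [->|vc]; case: (eqVneq t c) => [tc|tc] //.
- by rewrite eqxx.
- by rewrite eq_sym (negPf ta).
- by rewrite eq_sym (negPf av) tc (negPf vc).
Qed.

(** Once [a] is deleted from the list, moving [a] has no effect and any other move commutes with the
    deletion. The initial list [c :: s] without [a], with [c] renamed [a], is [s] with [a] moved to
    the front: hence the extra first move, which stands last in the word. *)
Lemma play_contract c a s x : uniq (c :: s) -> a != c ->
    {subset x <= c :: s} ->
  map (subst c a) (rem a (play (c :: s) x)) =
  play s (rcons (contract c a x) a).
Proof.
move=> us ac; have /= /andP[cs us'] := us.
elim: x => [|t x IHx] xs /=.
  rewrite eq_sym (negPf ac) /= /mtf /subst eqxx; congr (_ :: _).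
  rewrite -[RHS]map_id; apply/eq_in_map => v /mem_rem vs.
  by case: eqP vs cs => // -> ->.
have {}/IHx IHx : {subset x <= c :: s}.
  by move=> u ux; apply: xs; rewrite inE ux orbT.
have p : perm_eq (play (c :: s) x) (c :: s).
  by apply: perm_play => u ux; apply: xs; rewrite inE ux orbT.
rewrite /contract /=; case: (eqVneq t a) => [->|ta] //=.
rewrite -/(contract _ _ _) -IHx /mtf rem_comm map_subst_rem //.
by rewrite mem_rem_uniqF // (perm_uniq p).
Qed.

(** A word of length [m] over [s] has ['C(n, m)] preimages: choose the places that are not erased.
    Their letters are then determined, since renaming maps [c :: s] without [a] bijectively to
    [s]. *)
Lemma wsum_contract c a s n (g : seq T -> nat) : uniq (c :: s) -> a \in s ->
  wsum (c :: s) n (fun x => g (contract c a x)) =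
  \sum_(m < n.+1) 'C(n, m) * wsum s m g.
Proof.
move=> /= /andP[cs us] as_.
have ca : c != a by apply: contraNneq cs => ->.
elim: n g => [|n IHn] g; first by rewrite big_ord1 /= mul1n.
(* By first letter: [a] is erased and gives the blank case, [c] gives the term of [a], any other
   letter stands for itself. *)
rewrite wsum_binomial -IHn /= big_cons (bigD1_seq a) //=.
rewrite [X in _ = _ + X](bigD1_seq a) //= addnCA.
rewrite /contract /= ca /= eqxx /= /subst eqxx -/(subst c a).
congr (_ + (_ + _)); first by rewrite -IHn.
rewrite big_seq_cond [RHS]big_seq_cond; apply: eq_bigr => t /andP[ts ta].
rewrite -(IHn (fun x => g (t :: x))); apply: eq_wsum => x _ /=.
have /negPf tc : t != c by apply: contraNneq cs => <-.
by rewrite ta /= {1}/subst tc.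
Qed.

End MoveToFront.

(** * Full cycles and their number *)

Section FullCycle.
Variable T : finType.
Implicit Types (a c : T) (s w : seq T).

(* The map s_i |-> w_i is a full cycle on s, expressed by the absence of
   invariant sets other than the trivial ones. *)
Definition full s w :=
  [forall P : {set T}, all (fun p => (p.1 \in P) ==> (p.2 \in P)) (zip s w) ==>
     all (fun u => all (fun v => (u \in P) ==> (v \in P)) s) s].

Lemma fullP s w :
  reflect (forall P : {set T},
             (forall u v, (u, v) \in zip s w -> u \in P -> v \in P) ->
             forall u v, u \in s -> v \in s -> u \in P -> v \in P)
          (full s w).
Proof.
apply: (iffP forallP) => F P.
  move=> cl u v us vs; apply/implyP; move/implyP: (F P) => H.
  have /H/allP/(_ u us)/allP/(_ v vs) // : all
    (fun p => (p.1 \in P) ==> (p.2 \in P)) (zip s w).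
  by apply/allP => -[i j] /cl h; apply/implyP.
apply/implyP => /allP cl; apply/allP => u us; apply/allP => v vs; apply/implyP.
by apply: (F P) => // i j /cl /implyP.
Qed.

Lemma mem_zip_fst s w u v : (u, v) \in zip s w -> u \in s.
Proof.
elim: s w => [|i s IHs] [|j w] //=; rewrite !inE => /predU1P[[-> _]|/IHs->].
  by rewrite eqxx.
exact: orbT.
Qed.

(** The singleton of a fixed letter is a nontrivial invariant set. *)
Lemma full_fixed c s w : uniq (c :: s) -> 0 < size s ->
  full (c :: s) (c :: w) = false.
Proof.
case: s => // d s /= /andP[cs _] _; apply/negP => /fullP /(_ [set c]) F.
have /set1P dc : d \in [set c].
  apply: (F _ c d); rewrite ?inE ?eqxx ?orbT // => u v /predU1P[[-> ->]|].
    by rewrite inE.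
  by move=> /mem_zip_fst us /set1P uc; rewrite uc (negPf cs) in us.
by rewrite dc mem_head in cs.
Qed.

Lemma full_short_circuit c a s w : uniq (c :: s) -> size w = size s ->
  a \in s -> c \in w ->
  full (c :: s) (a :: w) = full s (map (subst c a) w).
Proof.
move=> /= /andP[cs us] sz as_ cw.
have ac : a != c by apply: contraNneq cs => <-.
have zE : zip s (map (subst c a) w) = [seq (p.1, subst c a p.2) | p <- zip s w].
  by elim: s w sz {cs us as_ cw} => [|u s IHs] [|v w] //= [sz]; rewrite IHs.
 apply/fullP/fullP => F P cl.
  (* In this preimage of [P], [c] belongs exactly when [a] is in [P]. *)
  have {}F := F [set v | subst c a v \in P].
  have sE u : u \in s -> subst c a u = u.
    by rewrite /subst; case: eqP => // -> h; rewrite h in cs.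
  move=> u v us' vs.
  have /[!inE] /[!sE] // := F _ u v; apply; rewrite ?us' ?vs ?orbT //.
  move=> i j /predU1P[[-> ->]|ij]; rewrite !inE.
    by rewrite /subst eqxx (negPf ac).
  have /mem_zip_fst is_ := ij; rewrite sE //; apply: cl; rewrite zE.
  by apply/mapP; exists (i, j).
have caP : c \in P -> a \in P by apply: cl; rewrite mem_head.
have {}F : forall u v, u \in s -> v \in s -> u \in P -> v \in P.
  apply: F => u v; rewrite zE => /mapP[[i j] ij [-> ->]] iP.
  have jP : j \in P by apply: (cl i) => //; rewrite inE ij orbT.
  by rewrite /subst; case: eqP jP => // -> /caP.
have acP : a \in P -> c \in P.
  (* The letter sent to [c] sits in [s] at the index of [c] in [w]; it lies in [P] because all of
     [s] does once [a] does. *)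
  move=> aP; have iw : index c w < size s by rewrite -sz index_mem.
  apply: (cl (nth a s (index c w))); last by apply: F aP => //; apply: mem_nth.
  rewrite inE -[X in (_, X) \in _](nth_index a cw) -nth_zip // mem_nth ?orbT //.
  by rewrite size_zip sz minnn.
move=> u v /predU1P[->|us'] /predU1P[->|vs] // uP.
- exact: F (caP uP).
- by apply: acP; apply: F uP.
- exact: F uP.
Qed.

Lemma wsum_full s n : uniq s -> 0 < size s ->
  wsum s n.+1 (fun x => full s (play s x)) = size s ^ n.
Proof.
elim: s n => // c [_ | d s IHs] n us _.
  rewrite (@eq_wsum _ _ _ _ (fun=> 1)) ?wsum_const ?exp1n // => x _.
  suff -> : full [:: c] (play [:: c] x) by [].
  by apply/fullP => P _ u v; rewrite !inE => /eqP-> /eqP->.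
set s' := d :: s in us IHs *; have us' : uniq s' by case/andP: us.
(* The head is the last move; if it is [c], then [c] is fixed and the term vanishes. *)
rewrite /= big_cons (@eq_wsum _ _ _ _ (fun=> 0)) ?wsum_const ?muln0 ?add0n;
  last by move=> x _; rewrite full_fixed.
rewrite (eq_big_seq (fun a => \sum_(m < n.+1) 'C(n, m) *
    wsum s' m (fun x => full s' (play s' (rcons x a))))); last first.
  move=> a as_.
  rewrite -(wsum_contract n (fun x => full s' (play s' (rcons x a))) us as_).
  apply: eq_wsum => x xs.
  have ac : a != c by case/andP: us => cs _; apply: contraNneq cs => <-.
  have p := perm_play xs.
  have ap : a \in play (c :: s') x by rewrite (perm_mem p) inE as_ orbT.
  rewrite -play_contract // -full_short_circuit //.
    by rewrite size_rem // (perm_size p).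
  by rewrite (rem_filter _ (etrans (perm_uniq p) us)) mem_filter /= eq_sym ac
             (perm_mem p) mem_head.
rewrite exchange_big /= (eq_bigr (fun m : 'I_n.+1 => 'C(n, m) * size s' ^ m)).
  by rewrite -[in RHS]addn1 addnC expnDn; apply: eq_bigr => m _;
     rewrite exp1n mul1n.
(* Letting [a] vary turns [rcons x a] into every word of length [m.+1], where the induction
   hypothesis applies. *)
move=> m _; rewrite -big_distrr /=; congr (_ * _).
by rewrite (wsum_rcons s' m (fun x => full s' (play s' x))) IHs.
Qed.

End FullCycle.

(** * From card sequences to moves to the front *)

Lemma single_full_cycleE b (s : 'S_b) : 0 < b ->
  single_full_cycle s = full (enum 'I_b) (map s (enum 'I_b)).
Proof.
move=> b0; have zE u v :
    (u, v) \in zip (enum 'I_b) (map s (enum 'I_b)) = (v == s u).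
  rewrite -[X in zip X]map_id zip_map; apply/mapP/eqP => [[j _ [-> ->]] //|->].
  by exists u; rewrite ?mem_enum.
apply/eqP/fullP => [E P cl u v _ _ uP | F].
  have: porbit s u \in porbits s by apply: imset_f.
  rewrite E => /set1P Eu; have: v \in porbit s u by rewrite Eu inE.
  case/porbitP => i ->; elim: i => [|i IHi]; first by rewrite expg0 perm1.
  by rewrite expgSr permM; apply: cl IHi; rewrite zE.
(* An orbit is itself a nonempty invariant set, hence everything. *)
have pE u : porbit s u = setT.
  apply/setP => v; rewrite inE; apply: (F _ _ u v);
    rewrite ?mem_enum ?porbit_id //.
  move=> i j; rewrite zE => /eqP-> /porbitP[k ->]; rewrite -permM -expgSr.
  exact: mem_porbit.
apply/setP => X; rewrite inE; apply/imsetP/eqP => [[u _ ->]|->].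
  exact: pE.
by exists (Ordinal b0); rewrite ?pE.
Qed.

(** Both sides read i, 0, ..., i - 1, i + 1, ..., b - 1 as lists of naturals. *)
Lemma map_pi_card b (i : 'I_b) :
  map (pi_card i) (enum 'I_b) = mtf i (enum 'I_b).
Proof.
have cE : map (pi_card i) (enum 'I_b) = map (card_fun i) (enum 'I_b).
  by apply: eq_map => j; rewrite permE.
apply: (inj_map val_inj); rewrite cE /mtf /= (rem_filter _ (enum_uniq _)).
have -> : [seq val j | j <- [seq j <- enum 'I_b | predC1 i j]] =
          [seq k <- iota 0 b | k != nat_of_ord i].
  by rewrite -val_enum_ord [RHS]filter_map; congr map; exact: eq_filter.
have -> : [seq val j | j <- map (card_fun i) (enum 'I_b)] =
    [seq (if k == 0 then nat_of_ord i else if k <= i then k.-1 else k)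
    | k <- iota 0 b].
  rewrite -val_enum_ord -!map_comp; apply: eq_map => j /=.
  by rewrite /card_fun; do 2?case: ifP.
have := ltn_ord i; move: (nat_of_ord i) => {cE}i ib.
have -> : b = i + (b - i.+1).+1 by rewrite addnS -addSn subnKC.
move: (b - _) => m; rewrite [in RHS]iotaD filter_cat /= eqxx /=.
rewrite -addSnnS iotaD map_cat /= add0n (iotaDl 1 0) -map_comp /=.
congr (_ :: _ ++ _).
  rewrite (@eq_in_filter _ _ predT) ?filter_predT => [|k].
    rewrite -[RHS]map_id; apply/eq_in_map => k; rewrite mem_iota /= add0n => ki.
    by rewrite /= add1n /= ki.
  by rewrite mem_iota /= add0n => /ltn_eqF ->.
rewrite (@eq_in_filter _ _ predT) ?filter_predT => [|k].
  rewrite -[RHS]map_id; apply/eq_in_map => k; rewrite mem_iota => /andP[ik _].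
  by rewrite leqNgt ik /=; case: k ik.
by rewrite mem_iota => /andP[/gtn_eqF -> _].
Qed.

(** Letters name final levels: a card played before [s] moves the letter [s i], not [i], which is
    the reading backwards in time. *)
Lemma map_pi_cardM b (i : 'I_b) (s : 'S_b) :
  map (pi_card i * s)%g (enum 'I_b) = mtf (s i) (map s (enum 'I_b)).
Proof.
rewrite (eq_map (g := s \o pi_card i)) => [|j]; last by rewrite permM.
rewrite map_comp map_pi_card /mtf /=.
rewrite !rem_filter ?(map_inj_uniq (@perm_inj _ s)) ?enum_uniq //.
rewrite (filter_map s); congr (_ :: map _ _); apply: eq_filter => j /=.
by rewrite (inj_eq perm_inj).
Qed.

Lemma big_tupleS (T : finType) n (F : seq T -> nat) :
  \sum_(A : n.+1.-tuple T) F A = \sum_(A : n.-tuple T) \sum_(t : T) F (t :: A).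
Proof.
rewrite pair_big /=.
rewrite (reindex (fun p : n.-tuple T * T => [tuple of p.2 :: p.1])) //=.
exists (fun A : n.+1.-tuple T => ([tuple of behead A], thead A)).
  move=> [A t] _.
  by rewrite /= theadE; congr pair; apply: val_inj.
by move=> A _; rewrite -tuple_eta.
Qed.

Lemma sum_pi_seq b n (G : seq 'I_b -> nat) :
  \sum_(A : n.-tuple 'I_b) G (map (pi_seq A) (enum 'I_b)) =
  wsum (enum 'I_b) n (fun x => G (play (enum 'I_b) x)).
Proof.
pose word (x : seq 'I_b) := map (\prod_(i <- x) pi_card i)%g (enum 'I_b).
rewrite -[LHS]/(\sum_(A : n.-tuple 'I_b) G (word A)).
elim: n G => [|n IHn] G.
  rewrite (big_pred1 [tuple]) => [|A]; last by rewrite /= tuple0.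
  rewrite /word big_nil /= (eq_map (g := id)) ?map_id // => j; exact: perm1.
rewrite (big_tupleS n (fun x => G (word x))) /=.
rewrite -(wsum_sum (enum 'I_b) _ n (fun t x => G (mtf t (play (enum 'I_b) x)))).
rewrite -(IHn (fun w => \sum_(t <- enum 'I_b) G (mtf t w))).
apply: eq_bigr => A _; rewrite big_enum /=.
(* For fixed later cards [A], the letter moved by the first card is its image under a permutation,
   so it runs through all letters once. *)
rewrite [RHS](reindex_inj (@perm_inj _ (\prod_(i <- A) pi_card i)%g)).
by apply: eq_bigr => i _; rewrite -map_pi_cardM /word big_cons.
Qed.

Theorem theorem6p1 (b n : nat) (hb : 1 <= b) (hn : 1 <= n) :
  iid_prob (@uniform_pmf 'I_b)
    (fun A : n.-tuple 'I_b => single_full_cycle (pi_seq A))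
  = (1 / b%:R)%R.
Proof.
case: n hn => // n _; rewrite /iid_prob /uniform_pmf card_ord.
(* All sequences have the same mass, so it remains to count the favourable ones: there are [b ^ n],
   with [n.+1] cards. *)
rewrite (eq_bigr (fun=> (b%:R ^-1 ^+ n.+1)%R)) => [|A _]; last first.
  by rewrite prodr_const card_ord.
rewrite sumr_const -sum1_card big_mkcond /=.
rewrite (eq_bigr (fun A : n.+1.-tuple 'I_b =>
    nat_of_bool (full (enum 'I_b) (map (pi_seq A) (enum 'I_b))))); last first.
  by move=> A _; rewrite -single_full_cycleE // unfold_in; case: ifP.
rewrite (sum_pi_seq n.+1 (fun w => full (enum 'I_b) w)).
rewrite wsum_full ?enum_uniq ?size_enum_ord //.
have b0 : (b%:R != 0 :> rat)%R by rewrite pnatr_eq0 -lt0n.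
by rewrite -[LHS]mulr_natl natrX exprS mulrCA -exprMn divff // expr1n mulr1
           div1r.
Qed.
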